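(* Let $n,l\ge1$, $k\ge n+l$, $\rho\in(0,1)$, let $\mathbf{x}_1,\dots,\mathbf{x}_{k+2}\in\mathbb{R}^n$ and $\boldsymbol{\gamma}_1,\dots,\boldsymbol{\gamma}_{k+1}\in\mathbb{R}^l$, and put $\mathbf{y}_j=\mathbf{x}_{j+1}$ and $\mathbf{x}^c_j=\begin{bmatrix}\mathbf{x}_j\\ \boldsymbol{\gamma}_j\end{bmatrix}\in\mathbb{R}^{n+l}$. Let $$\mathbf{X}_k=\begin{bmatrix}\rho^{k-1}\mathbf{x}_1&\cdots&\mathbf{x}_k\end{bmatrix},\quad \mathbf{\Gamma}_k=\begin{bmatrix}\rho^{k-1}\boldsymbol{\gamma}_1&\cdots&\boldsymbol{\gamma}_k\end{bmatrix},\quad \mathbf{X}^c_k=\begin{bmatrix}\mathbf{X}_k\\ \mathbf{\Gamma}_k\end{bmatrix},\quad \mathbf{X}_{k+1}=\begin{bmatrix}\rho\mathbf{X}_k&\mathbf{x}_{k+1}\end{bmatrix},\quad \mathbf{X}^c_{k+1}=\begin{bmatrix}\rho\mathbf{X}^c_k&\mathbf{x}^c_{k+1}\end{bmatrix}.$$ Let $\mathbf{X}^c_k=\mathbf{U}^c_{x_k}\mathbf{\Sigma}^c_{x_k}\mathbf{V}^{c*}_{x_k}$ and $\mathbf{X}_k=\mathbf{U}_{x_k}\mathbf{\Sigma}_{x_k}\mathbf{V}_{x_k}^*$ be singular value decompositions, and assume that the pair $(\mathbf{A}^{\rho_c}_k,\mathbf{B}^{\rho_c}_k)\in\mathbb{R}^{n\times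 n}\times\mathbb{R}^{n\times l}$ minimizes $$J^c_k(\mathbf{A},\mathbf{B})=\sum_{j=1}^{k}\left\|\rho^{k-j}\left(\mathbf{y}_j-\mathbf{A}\mathbf{x}_j-\mathbf{B}\boldsymbol{\gamma}_j\right)\right\|^2 .$$ Let the SVDs of $\mathbf{X}^c_{k+1}=\mathbf{U}^c_{x_{k+1}}\mathbf{\Sigma}^c_{x_{k+1}}\mathbf{V}^{c*}_{x_{k+1}}$ and of $\mathbf{X}_{k+1}$ be computed by the weighted incremental SVD update (defined in the context) from those of $\mathbf{X}^c_k$ and $\mathbf{X}_k$ with new data $\mathbf{x}^c_{k+1}$ and $\mathbf{x}_{k+1}$ respectively; let $\mathbf{v}^c_{s_{k,2}}\in\mathbb{C}^{1\times(n+l)}$ be the row vector produced by the update for $\mathbf{X}^c_{k+1}$, suppose $\mathbf{\Sigma}^c_{x_{k+1}}$ is invertible, and partition $\mathbf{U}^{c*}_{x_{k+1}}=\begin{bmatrix}\mathbf{U}^{c_a*}_{x_{k+1}}&\mathbf{U}^{c_b*}_{x_{k+1}}\end{bmatrix}$ with $\mathbf{U}^{c_a}_{x_{k+1}}\in\mathbb{C}^{n\times(n+l)}$ and $\mathbf{U}^{c_b}_{x_{k+1}}\in\mathbb{C}^{l\times(n+l)}$. Then the pair $(\mathbf{A}^{\rho_c}_{k+1},\mathbf{B}^{\rho_c}_{k+1})\in\mathbb{R}^{n\times n}\times\mathbb{R}^{n\times l}$ which minimizes $J^c_{k+1}(\mathbf{A},\mathbf{B})=\sum_{j=1}^{k+1}\|\rho^{k+1-j}(\mathbf{y}_j-\mathbf{A}\mathbf{x}_j-\mathbf{B}\boldsymbol{\gamma}_j)\|^2$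 is $$\mathbf{A}^{\rho_c}_{k+1}=\mathbf{A}^{\rho_c}_k+\left(\mathbf{y}_{k+1}-\mathbf{A}^{\rho_c}_k\mathbf{x}_{k+1}-\mathbf{B}^{\rho_c}_k\boldsymbol{\gamma}_{k+1}\right)\mathbf{v}^c_{s_{k,2}}(\mathbf{\Sigma}^c_{x_{k+1}})^{-1}\mathbf{U}^{c_a*}_{x_{k+1}},$$ $$\mathbf{B}^{\rho_c}_{k+1}=\mathbf{B}^{\rho_c}_k+\left(\mathbf{y}_{k+1}-\mathbf{A}^{\rho_c}_k\mathbf{x}_{k+1}-\mathbf{B}^{\rho_c}_k\boldsymbol{\gamma}_{k+1}\right)\mathbf{v}^c_{s_{k,2}}(\mathbf{\Sigma}^c_{x_{k+1}})^{-1}\mathbf{U}^{c_b*}_{x_{k+1}}.$$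
   Context: $\|\cdot\|$ is the Euclidean norm and $(\cdot)^*$ the conjugate transpose. SVD convention: for an $N\times k$ matrix with $k\ge N$, an SVD $\mathbf{U}\mathbf{\Sigma}\mathbf{V}^*$ has $\mathbf{U}\in\mathbb{C}^{N\times N}$ unitary, $\mathbf{\Sigma}\in\mathbb{C}^{N\times N}$ diagonal with nonnegative real entries, and $\mathbf{V}\in\mathbb{C}^{k\times N}$ with orthonormal columns. Weighted incremental SVD update: given an $N\times k$ matrix $\mathbf{Z}$ with SVD $\mathbf{Z}=\mathbf{U}\mathbf{\Sigma}\mathbf{V}^*$ and a new column $\mathbf{z}\in\mathbb{R}^N$, take an SVD $$\mathbf{S}=\begin{bmatrix}\mathbf{\Sigma}&\rho^{-1}\mathbf{U}^*\mathbf{z}\end{bmatrix}=\mathbf{U}_s\mathbf{\Sigma}_s\mathbf{V}_s^*,$$ with $\mathbf{U}_s,\mathbf{\Sigma}_s\in\mathbb{C}^{N\times N}$, $\mathbf{V}_s\in\mathbb{C}^{(N+1)\times N}$, and partition $\mathbf{V}_s=\begin{bmatrix}\mathbf{V}_{s,1}\\ \mathbf{v}_{s,2}\end{bmatrix}$ with $\mathbf{V}_{s,1}\in\mathbb{C}^{N\times N}$ and $\mathbf{v}_{s,2}\in\mathbb{C}^{1\times N}$ (the last row). The SVD of $\begin{bmatrix}\rho\mathbf{Z}&\mathbf{z}\end{bmatrix}$ produced by the update has factors $\mathbf{U}\mathbf{U}_s$, $\rho\mathbf{\Sigma}_s$, and $\begin{bmatrix}\mathbf{V}\mathbf{V}_{s,1}\\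 \mathbf{v}_{s,2}\end{bmatrix}$. In the claim, $\mathbf{v}^c_{s_{k,2}}$ denotes $\mathbf{v}_{s,2}$ when the update is applied with $N=n+l$, $\mathbf{Z}=\mathbf{X}^c_k$, $\mathbf{z}=\mathbf{x}^c_{k+1}$. *)

(* Defs.v *)
From HB Require Import structures.
From mathcomp Require Import all_boot all_order all_algebra.
From mathcomp Require Import complex reals.

Set Implicit Arguments.
Unset Strict Implicit.
Unset Printing Implicit Defensive.

Import Order.TTheory GRing.Theory Num.Theory.
Local Open Scope ring_scope.
Local Open Scope complex_scope.
Local Open Scope sesquilinear_scope.

Definition cplx_mx (R : realType) m n (A : 'M[R]_(m, n)) : 'M[R[i]]_(m, n) :=
  map_mx (real_complex R) A.

Definition enorm (R : realType) n (v : 'cV[R]_n) : R :=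
  Num.sqrt (\sum_(i < n) v i 0 ^+ 2).

(* The order of [C] makes [0 <= z] say that [z] is real and nonnegative.
   Singular values are not required to be sorted. *)
Definition is_svd (C : numClosedFieldType) N k (Z : 'M[C]_(N, k))
    (U Sg : 'M[C]_N) (V : 'M[C]_(k, N)) : Prop :=
  [/\ U \is unitarymx,
      is_diag_mx Sg,
      forall i, 0 <= Sg i i,
      V^t* *m V = 1%:M
    & Z = U *m Sg *m V^t*].

(* [U', Sg', V'] are factors that the update can return from the factors
   [U, Sg, V] of [Z] and the new column [z], and [v2] is the last row of the
   right factor of the intermediate decomposition.  It is a relation because
   that intermediate decomposition is not unique. *)
Definition svd_update (C : numClosedFieldType) N k (rho : C) (z : 'cV[C]_N)
    (U Sg : 'M[C]_N) (V : 'M[C]_(k, N))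
    (U' Sg' : 'M[C]_N) (V' : 'M[C]_(k + 1, N)) (v2 : 'rV[C]_N) : Prop :=
  exists (Us Ss : 'M[C]_N) (Vs : 'M[C]_(N + 1, N)),
    is_svd (row_mx Sg (rho^-1 *: (U^t* *m z))) Us Ss Vs /\
    [/\ U' = U *m Us,
        Sg' = rho *: Ss,
        V' = col_mx (V *m usubmx Vs) (dsubmx Vs)
      & v2 = dsubmx Vs].

Lemma svd_update_is_svd (C : numClosedFieldType) N k (rho : C)
    (Z : 'M[C]_(N, k)) (z : 'cV[C]_N) (U Sg : 'M[C]_N) (V : 'M[C]_(k, N))
    (U' Sg' : 'M[C]_N) (V' : 'M[C]_(k + 1, N)) (v2 : 'rV[C]_N) :
  0 < rho -> is_svd Z U Sg V -> svd_update rho z U Sg V U' Sg' V' v2 ->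
  is_svd (row_mx (rho *: Z) z) U' Sg' V'.
Proof.
move=> rho0 [Uu dS pS VV ->] [Us [Ss [Vs [[Usu dSs pSs VVs eS] [-> -> -> _]]]]].
set Va := usubmx Vs; set vb := dsubmx Vs.
have eVs : Vs = col_mx Va vb by rewrite vsubmxK.
have tcol p (A : 'M[C]_(p, N)) (b : 'M[C]_(1, N)) :
  (col_mx A b)^t* = row_mx (A^t*) (b^t*) by rewrite tr_col_mx map_row_mx.
have tmul p q r (A : 'M[C]_(p, q)) (B : 'M[C]_(q, r)) :
  (A *m B)^t* = B^t* *m A^t* by rewrite trmx_mul map_mxM.
split.
- exact: mul_unitarymx.
- apply/is_diag_mxP => i j ij; rewrite mxE (is_diag_mxP dSs) ?mulr0//.
- by move=> i; rewrite mxE mulr_ge0 // ltW.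
- rewrite tcol mul_row_col tmul -mulmxA (mulmxA _ V) VV mul1mx.
  by rewrite -mul_row_col -tcol -eVs.
- move: eS; rewrite eVs tcol mul_mx_row => /eq_row_mx[eS eZ].
  rewrite tcol tmul mul_mx_row -!scalemxAr -!scalemxAl -!mulmxA; congr row_mx.
    rewrite (mulmxA Ss) (mulmxA Us) (mulmxA Us) -eS.
    by rewrite !mulmxA.
  rewrite (mulmxA Us) -eZ -scalemxAr scalerA mulfV ?gt_eqF // scale1r.
  by rewrite mulmxA -(invmx_unitary Uu) mulmxV ?mul1mx // unitarymx_unit.
Qed.

(* The sequence is indexed from 1, so the columns are
   [rho ^+ (k - 1) *: v 1, ..., v k]; the ordinal [j] stands for [j.+1]. *)
Definition weighted_cols (R : realType) n (rho : R) (v : nat -> 'cV[R]_n)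
    (k : nat) : 'M[R]_(n, k) :=
  \matrix_(i < n, j < k) (rho ^+ (k - j.+1) * v j.+1 i 0).

Definition weighted_cost (R : realType) n l (rho : R)
    (x y : nat -> 'cV[R]_n) (g : nat -> 'cV[R]_l) (k : nat)
    (A : 'M[R]_n) (B : 'M[R]_(n, l)) : R :=
  \sum_(1 <= j < k.+1)
    enorm (rho ^+ (k - j) *: (y j - A *m x j - B *m g j)) ^+ 2.

Definition minimizes (R : realType) n l (J : 'M[R]_n -> 'M[R]_(n, l) -> R)
    (A : 'M[R]_n) (B : 'M[R]_(n, l)) : Prop :=
  forall A' B', J A B <= J A' B'.

(* Main.v *)
Require Import Defs.
From HB Require Import structures.
From mathcomp Require Import all_boot all_order all_algebra.
From mathcomp Require Import complex reals ring lra.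

Set Implicit Arguments.
Unset Strict Implicit.
Unset Printing Implicit Defensive.

Import Order.TTheory GRing.Theory Num.Theory.
Local Open Scope ring_scope.
Local Open Scope complex_scope.
Local Open Scope sesquilinear_scope.

(* Writing M = [A B], the pair minimizes the cost exactly when M satisfies the
   normal equations (Y - M X) X^T = 0, and the solution is unique when X X^T is
   invertible.  At step k + 1 the matrix X is X1 = [rho X, z] and the residual
   of the old minimizer is [rho E, e] with E X^T = 0, so its product with X1^T
   is e z^T, and adding e z^T (X1 X1^T)^-1 to M restores the normal equations.
   The decomposition X1 = U S V^*, where V has last row v, gives
   z^T (X1 X1^T)^-1 = v S^-1 U^*. *)

(** The squared Frobenius norm, kept free of square roots so that it is polynomial in the entries
    and makes sense over any ring. *)
Definition frob2 (R : pzRingType) m n (A : 'M[R]_(m, n)) : R :=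
  \sum_i \sum_j A i j ^+ 2.

Lemma frob2E (R : comPzRingType) m n (A : 'M[R]_(m, n)) :
  frob2 A = \tr (A *m A^T).
Proof.
apply: eq_bigr => i _; rewrite mxE; apply: eq_bigr => j _.
by rewrite mxE expr2.
Qed.

Lemma frob2_ge0 (R : realDomainType) m n (A : 'M[R]_(m, n)) : 0 <= frob2 A.
Proof. by apply: sumr_ge0 => i _; apply: sumr_ge0 => j _; exact: sqr_ge0. Qed.

Lemma frob2_eq0 (R : realDomainType) m n (A : 'M[R]_(m, n)) :
  frob2 A = 0 -> A = 0.
Proof.
move=> A0; apply/matrixP => i j; rewrite mxE; apply/eqP.
have rowi0 : \sum_j A i j ^+ 2 = 0.
  apply: (psumr_eq0P (P := xpredT) _ A0) => // a _.
  by apply: sumr_ge0 => b _; exact: sqr_ge0.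
rewrite -sqrf_eq0; apply/eqP.
by apply: (psumr_eq0P (P := xpredT) _ rowi0) => // b _; exact: sqr_ge0.
Qed.

Lemma frob2_row (R : pzRingType) m n1 n2 (A : 'M[R]_(m, n1))
    (B : 'M[R]_(m, n2)) : frob2 (row_mx A B) = frob2 A + frob2 B.
Proof.
rewrite /frob2 -big_split; apply: eq_bigr => i _ /=; rewrite big_split_ord /=.
by congr (_ + _); apply: eq_bigr => j _; rewrite (row_mxEl, row_mxEr).
Qed.

Lemma frob2Z (R : comPzRingType) m n (a : R) (A : 'M[R]_(m, n)) :
  frob2 (a *: A) = a ^+ 2 * frob2 A.
Proof.
rewrite /frob2 mulr_sumr; apply: eq_bigr => i _.
by rewrite mulr_sumr; apply: eq_bigr => j _; rewrite mxE exprMn.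
Qed.

Lemma frob2B (R : comPzRingType) m n (A B : 'M[R]_(m, n)) :
  frob2 (A - B) = frob2 A - \tr (A *m B^T) *+ 2 + frob2 B.
Proof.
rewrite !frob2E raddfB /= mulmxBl !mulmxBr !raddfB /=.
have -> : \tr (B *m A^T) = \tr (A *m B^T).
  by rewrite -mxtrace_tr trmx_mul trmxK.
by rewrite opprK mulr2n opprD !addrA.
Qed.

(** The cost expands exactly around [M] into a constant, a term linear in [M' - M] with coefficient
    [E *m X^T], and a nonnegative square. If the linear term vanishes, [M] is optimal; otherwise
    [E *m X^T] is itself a descent direction. *)
Lemma least_squares_normal_eq (R : realFieldType) p N k (Y : 'M[R]_(p, k))
    (X : 'M[R]_(N, k)) (M : 'M[R]_(p, N)) :
  (forall M', frob2 (Y - M *m X) <= frob2 (Y - M' *m X)) <->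
  (Y - M *m X) *m X^T = 0.
Proof.
set E := Y - M *m X.
have shift M' : frob2 (Y - M' *m X) =
    frob2 E - \tr (E *m X^T *m (M' - M)^T) *+ 2 + frob2 ((M' - M) *m X).
  have -> : Y - M' *m X = E - (M' - M) *m X.
    by rewrite mulmxBl opprB addrA subrK.
  by rewrite frob2B trmx_mul mulmxA.
split=> [minM | E0 M']; last first.
  by rewrite shift E0 mul0mx mxtrace0 mul0rn subr0 lerDl frob2_ge0.
set D := E *m X^T; apply: frob2_eq0.
set a := frob2 D; set c := frob2 (D *m X).
have c0 : 0 <= c by exact: frob2_ge0.
(* Moving from M in the direction t D changes the cost by c t^2 - 2 a t. *)
have quad t : 0 <= t ^+ 2 * c - (t * a) *+ 2.
  have := minM (M + t *: D); rewrite shift.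
  rewrite [M + _]addrC addrK -scalemxAl frob2Z -/c.
  rewrite linearZ /= -scalemxAr linearZ /= -frob2E -/a.
  by rewrite -addrA lerDl addrC.
(* The step length is t = a / (c + 1) rather than the optimal a / c, since c may be 0. With s = 1 /
   (c + 1) the change of cost is - s (1 + s) a^2, which is nonnegative only if a = 0. *)
have c1 : 0 < c + 1 by lra.
have s0 : 0 < (c + 1)^-1 by rewrite invr_gt0.
have sc : (c + 1)^-1 * c = 1 - (c + 1)^-1.
  by rewrite -{2}(addrK 1 c) mulrBr mulVf ?gt_eqF // mulr1.
move: s0 sc (quad ((c + 1)^-1 * a)); set s := (c + 1)^-1 => s0 sc.
have -> : (s * a) ^+ 2 * c - (s * a * a) *+ 2 = - (s * (1 + s) * a ^+ 2).
  transitivity (s * c * s * a ^+ 2 - (s * a ^+ 2) *+ 2); first by ring.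
  by rewrite sc; ring.
rewrite oppr_ge0 pmulr_rle0; last by rewrite mulr_gt0 // addr_gt0.
by move=> a2; apply/eqP; rewrite -sqrf_eq0 eq_le a2 sqr_ge0.
Qed.

Lemma mulmx_weighted_cols (R : realType) m n (rho : R) (A : 'M[R]_(m, n))
    (v : nat -> 'cV[R]_n) k :
  A *m weighted_cols rho v k = weighted_cols rho (fun j => A *m v j) k.
Proof.
apply/matrixP => i j; rewrite !mxE mulr_sumr; apply: eq_bigr => a _.
by rewrite !mxE mulrCA.
Qed.

Lemma enorm_sqr (R : realType) n (v : 'cV[R]_n) : enorm v ^+ 2 = frob2 v.
Proof.
rewrite sqr_sqrtr; last by apply: sumr_ge0 => i _; exact: sqr_ge0.
by apply: eq_bigr => i _; rewrite big_ord1.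
Qed.

Lemma weighted_costE (R : realType) n l (rho : R) (x y : nat -> 'cV[R]_n)
    (g : nat -> 'cV[R]_l) k A B :
  weighted_cost rho x y g k A B =
  frob2 (weighted_cols rho y k -
    row_mx A B *m col_mx (weighted_cols rho x k) (weighted_cols rho g k)).
Proof.
rewrite mul_row_col !mulmx_weighted_cols /weighted_cost big_add1 big_mkord.
rewrite /frob2 exchange_big; apply: eq_bigr => j _.
rewrite enorm_sqr; apply: eq_bigr => i _; rewrite big_ord1 !mxE /=.
by rewrite !mulrBr opprD addrA.
Qed.

Lemma weighted_cost_recr (R : realType) n l (rho : R) (x y : nat -> 'cV[R]_n)
    (g : nat -> 'cV[R]_l) k A B :
  weighted_cost rho x y g k.+1 A B =
  rho ^+ 2 * weighted_cost rho x y g k A B +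
  frob2 (y k.+1 - A *m x k.+1 - B *m g k.+1).
Proof.
rewrite /weighted_cost big_nat_recr //= subnn expr0 scale1r enorm_sqr.
congr (_ + _); rewrite mulr_sumr; apply: eq_big_nat => j /andP[_ jk].
by rewrite !enorm_sqr subSn // exprS -scalerA frob2Z.
Qed.

(** Going through the recursion in [k] gives the data directly as an old block scaled by [rho] and
    an appended column, with no need to identify matrices of [k.+1] and of [k + 1] columns. *)
Lemma weighted_costS (R : realType) n l (rho : R) (x y : nat -> 'cV[R]_n)
    (g : nat -> 'cV[R]_l) k A B :
  weighted_cost rho x y g k.+1 A B =
  frob2 (row_mx (rho *: weighted_cols rho y k) (y k.+1) - row_mx A B *m
    row_mx (rho *: col_mx (weighted_cols rho x k) (weighted_cols rho g k))
           (col_mx (x k.+1) (g k.+1))).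
Proof.
rewrite weighted_cost_recr weighted_costE mul_mx_row opp_row_mx add_row_mx.
rewrite frob2_row -scalemxAr -scalerBr frob2Z.
by rewrite [_ *m col_mx (x _) _]mul_row_col opprD addrA.
Qed.

Lemma minimizes_row (R : realType) n l (J : 'M[R]_n -> 'M[R]_(n, l) -> R)
    N (Y : 'M[R]_(n, N)) X A B :
  (forall A B, J A B = frob2 (Y - row_mx A B *m X)) ->
  minimizes J A B <-> (Y - row_mx A B *m X) *m X^T = 0.
Proof.
move=> JE; rewrite -least_squares_normal_eq; split=> [minJ M' | minM A' B'].
  by rewrite -(hsubmxK M') -!JE; exact: minJ.
by rewrite !JE.
Qed.

(** Being an equivalence, this gives existence and uniqueness of the updated solution at once. *)
Lemma normal_eq_update (R : comUnitRingType) p N k (rho : R)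
    (Y : 'M[R]_(p, k)) (X : 'M[R]_(N, k)) (w : 'cV[R]_p) (z : 'cV[R]_N)
    (M M' : 'M[R]_(p, N)) :
  let X1 := row_mx (rho *: X) z in
  X1 *m X1^T \in unitmx -> (Y - M *m X) *m X^T = 0 ->
  (row_mx (rho *: Y) w - M' *m X1) *m X1^T = 0 <->
  M' = M + (w - M *m z) *m (z^T *m invmx (X1 *m X1^T)).
Proof.
move=> X1 Gu E0; set Y1 := row_mx _ w; set G := X1 *m X1^T.
have resM : Y1 *m X1^T - M *m G = (w - M *m z) *m z^T.
  rewrite mulmxA -mulmxBl mul_mx_row opp_row_mx add_row_mx tr_row_mx.
  rewrite mul_row_col -scalemxAr -scalerBr linearZ /= -scalemxAr -scalemxAl.
  by rewrite E0 !scaler0 add0r.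
rewrite mulmxBl -mulmxA -/G -(subrK (M *m G) (Y1 *m X1^T)) resM.
(* From here [G] is an arbitrary invertible matrix, and what remains is to solve D + M G - M' G = 0
   for M'. *)
rewrite (mulmxA (w - _)); rewrite -/G in Gu; move: G Gu {resM} => G Gu.
set D := _ *m z^T.
split=> [/subr0_eq MG | ->].
  by rewrite -(mulmxK Gu M') -MG mulmxDl mulmxK // addrC.
by rewrite mulmxDl mulmxKV // [D + _]addrC subrr.
Qed.

(** Since V^* V = 1, the Gram matrix is G = U S S^* U^*, a product of invertible factors. The last
    column is z = U S v^* with v the last row of V, so z^* = v S^* U^*, and the factor S^* U^*
    cancels against G^-1. *)
Lemma svd_gain (C : numClosedFieldType) N k (X : 'M[C]_(N, k)) (z : 'cV[C]_N)
    (U S : 'M[C]_N) (V : 'M[C]_(k + 1, N)) :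
  is_svd (row_mx X z) U S V -> S \in unitmx ->
  let G := row_mx X z *m (row_mx X z)^t* in
  G \in unitmx /\ z^t* *m invmx G = dsubmx V *m invmx S *m U^t*.
Proof.
have tmul p q r (A : 'M[C]_(p, q)) (B : 'M[C]_(q, r)) :
  (A *m B)^t* = B^t* *m A^t* by rewrite trmx_mul map_mxM.
move=> [Uu _ _ VV XE] Su G.
have UU : U^t* *m U = 1%:M.
  by rewrite -(invmx_unitary Uu) mulVmx // unitarymx_unit.
have GE : G = U *m S *m S^t* *m U^t*.
  by rewrite /G XE !tmul trmxCK -!mulmxA (mulmxA (V^t*)) VV mul1mx.
have tu (A : 'M[C]_N) : A \in unitmx -> A^t* \in unitmx.
  by rewrite map_unitmx unitmx_tr.
have Gu : G \in unitmx.
  by rewrite GE !unitmx_mul Su !tu // unitarymx_unit.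
split=> //.
have zE : z = U *m S *m (dsubmx V)^t*.
  move: XE; rewrite -{1}(vsubmxK V) tr_col_mx map_row_mx mul_mx_row.
  by move=> /eq_row_mx[].
rewrite -[RHS](mulmxK Gu); congr (_ *m _).
rewrite GE zE !tmul trmxCK -!mulmxA (mulmxA (U^t*) U) UU mul1mx.
by rewrite (mulmxA (invmx S)) mulVmx // mul1mx.
Qed.

(** Conjugation fixes real entries; this turns the complex Gram matrix of [svd_gain] into the image
    of a real one. *)
Lemma cplx_mx_tr (R : realType) m n (A : 'M[R]_(m, n)) :
  (cplx_mx A)^t* = cplx_mx A^T.
Proof. by apply/matrixP => i j; rewrite !mxE; exact: conjc_real. Qed.

Theorem theorem3 (R : realType) (n l k : nat) (rho : R)
    (x : nat -> 'cV[R]_n) (g : nat -> 'cV[R]_l)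
    (hn : (1 <= n)%N) (hl : (1 <= l)%N) (hk : (n + l <= k)%N)
    (hrho0 : 0 < rho) (hrho1 : rho < 1) :
  let y : nat -> 'cV[R]_n := fun j => x j.+1 in
  let xc : nat -> 'cV[R]_(n + l) := fun j => col_mx (x j) (g j) in
  let Xk : 'M[R]_(n, k) := weighted_cols rho x k in
  let Gk : 'M[R]_(l, k) := weighted_cols rho g k in
  let Xck : 'M[R]_(n + l, k) := col_mx Xk Gk in
  let Xk1 : 'M[R]_(n, k + 1) := row_mx (rho *: Xk) (x k.+1) in
  let Xck1 : 'M[R]_(n + l, k + 1) := row_mx (rho *: Xck) (xc k.+1) in
  forall (Uc Sc : 'M[R[i]]_(n + l)) (Vc : 'M[R[i]]_(k, n + l))
    (U S : 'M[R[i]]_n) (V : 'M[R[i]]_(k, n))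
    (hXck : is_svd (cplx_mx Xck) Uc Sc Vc)
    (hXk : is_svd (cplx_mx Xk) U S V)
    (Ak : 'M[R]_n) (Bk : 'M[R]_(n, l))
    (hmin : minimizes (weighted_cost rho x y g k) Ak Bk)
    (Uc1 Sc1 : 'M[R[i]]_(n + l)) (Vc1 : 'M[R[i]]_(k + 1, n + l))
    (vc2 : 'rV[R[i]]_(n + l))
    (U1 S1 : 'M[R[i]]_n) (V1 : 'M[R[i]]_(k + 1, n)) (v2 : 'rV[R[i]]_n)
    (hXck1 : is_svd (cplx_mx Xck1) Uc1 Sc1 Vc1)
    (hupdc : svd_update rho%:C (cplx_mx (xc k.+1)) Uc Sc Vc Uc1 Sc1 Vc1 vc2)
    (hXk1 : is_svd (cplx_mx Xk1) U1 S1 V1)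
    (hupd : svd_update rho%:C (cplx_mx (x k.+1)) U S V U1 S1 V1 v2)
    (hinv : Sc1 \in unitmx),
  let Uca : 'M[R[i]]_(n, n + l) := usubmx Uc1 in
  let Ucb : 'M[R[i]]_(l, n + l) := dsubmx Uc1 in
  let e : 'cV[R]_n := y k.+1 - Ak *m x k.+1 - Bk *m g k.+1 in
  exists (Ak1 : 'M[R]_n) (Bk1 : 'M[R]_(n, l)),
    [/\ forall (A : 'M[R]_n) (B : 'M[R]_(n, l)),
          minimizes (weighted_cost rho x y g k.+1) A B <->
          A = Ak1 /\ B = Bk1,
        cplx_mx Ak1 =
          cplx_mx Ak + cplx_mx e *m vc2 *m invmx Sc1 *m Uca^t*
      & cplx_mx Bk1 =
          cplx_mx Bk + cplx_mx e *m vc2 *m invmx Sc1 *m Ucb^t*].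
Proof.
move=> y xc Xk Gk Xck Xk1 Xck1 Uc Sc Vc U S V hXck hXk Ak Bk hmin.
move=> Uc1 Sc1 Vc1 vc2 U1 S1 V1 v2 hXck1 hupdc hXk1 hupd hinv Uca Ucb e.
have vE : dsubmx Vc1 = vc2.
  by have [Us [Ss [Vs [_ [_ _ -> ->]]]]] := hupdc; rewrite col_mxKd.
set G := Xck1 *m Xck1^T; set K := (xc k.+1)^T *m invmx G.
have X1E : cplx_mx Xck1 = row_mx (cplx_mx (rho *: Xck)) (cplx_mx (xc k.+1)).
  by rewrite /cplx_mx map_row_mx.
(* Invertibility of the complex Gram matrix descends to the real [G], because the embedding of the
   reals is a field morphism. *)
have [Gu KE] : G \in unitmx /\ cplx_mx K = vc2 *m invmx Sc1 *m Uc1^t*.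
  have := svd_gain; rewrite X1E in hXck1; move/(_ _ _ _ _ _ _ _ _ hXck1 hinv).
  rewrite -X1E !cplx_mx_tr vE /cplx_mx -map_mxM map_unitmx => -[Gu <-].
  by rewrite -map_invmx -map_mxM.
have norm0 := (minimizes_row _ _ (weighted_costE rho x y g k)).1 hmin.
have norm1 A B : minimizes (weighted_cost rho x y g k.+1) A B <->
    row_mx A B = row_mx Ak Bk + e *m K.
  rewrite (minimizes_row _ _ (weighted_costS rho x y g k)).
  rewrite (normal_eq_update _ _ Gu norm0).
  by rewrite mul_row_col opprD addrA.
have Uc1E : Uc1^t* = row_mx (Uca^t*) (Ucb^t*).
  by rewrite -map_row_mx -tr_col_mx vsubmxK.
have eKE : cplx_mx (e *m K) =
    row_mx (cplx_mx e *m vc2 *m invmx Sc1 *m Uca^t*)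
           (cplx_mx e *m vc2 *m invmx Sc1 *m Ucb^t*).
  by rewrite /cplx_mx map_mxM -!/(cplx_mx _) KE Uc1E -mul_mx_row !mulmxA.
(* The witnesses are cut out of the real matrix [e *m K], so the complex expressions in the two
   formulas are seen to have real values. *)
exists (Ak + lsubmx (e *m K)), (Bk + rsubmx (e *m K)); split=> [A B||].
- rewrite norm1 -{1}(hsubmxK (e *m K)) add_row_mx.
  by split=> [/eq_row_mx|[-> ->]].
- by rewrite /cplx_mx map_mxD map_lsubmx -!/(cplx_mx _) eKE row_mxKl.
- by rewrite /cplx_mx map_mxD map_rsubmx -!/(cplx_mx _) eKE row_mxKr.
Qed.
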